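(* If $(R,\mathfrak m,k)$ is a local ring and $x$ is a Conca generator of $\mathfrak m$, then every finite $R$-module $M$ annihilated by $x$ (that is, with $xM=0$) is Koszul.
   Context: A local ring $(R,\mathfrak m,k)$ is a commutative Noetherian ring $R$ with unique maximal ideal $\mathfrak m$ and residue field $k=R/\mathfrak m$. ''Finite'' means finitely generated. Conca generator: an element $x$ is a Conca generator of an ideal $J$ if $x\in J$, $x\neq0=x^2$ and $xJ=J^2$. Koszul: let $F$ be a minimal free resolution of a finite $R$-module $M$. For each $j\ge0$ the differential and the augmentation induce a complex of $k$-vector spaces $$\operatorname{lin}_j(F)=\quad 0\to \frac{F_j}{\mathfrak mF_j}\to\cdots\to\frac{\mathfrak m^{j-n}F_n}{\mathfrak m^{j+1-n}F_n}\to\cdots\to\frac{\mathfrak m^{j}F_0}{\mathfrak m^{j+1}F_0}\to\frac{\mathfrak m^jM}{\mathfrak m^{j+1}M}\to0;$$ $M$ is Koszul if $\operatorname{lin}_j(F)$ is acyclic for every $j\ge0$. *)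

(* Defs.v *)
From HB Require Import structures.
From mathcomp Require Import all_boot all_order all_algebra.
From mathcomp Require Import generic_quotient ring_quotient boolp.

Set Implicit Arguments.
Unset Strict Implicit.
Unset Printing Implicit Defensive.

Import GRing.Theory.

Local Open Scope ring_scope.
Local Open Scope quotient_scope.

(* Submodules of an R-module V are the library's [submodClosed V]; an ideal   *)
(* of R is a submodule of the regular module R^o.                             *)
Notation ideal R := (submodClosed (R : comNzRingType)^o).

Definition fingen (R : comNzRingType) (V : lmodType R) :=
  exists n (g : 'I_n -> V), forall v, exists c : 'I_n -> R, v = \sum_i c i *: g i.

Definition finfree (R : comNzRingType) (V : lmodType R) :=
  exists n (f : {linear 'rV[R]_n -> V}), bijective f.

Section FullSubmodule.
Variables (R : comNzRingType) (V : lmodType R).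

Definition fullsm : {pred V} := predT.

Fact fullsm_closed : submod_closed fullsm.
Proof. by split. Qed.

HB.instance Definition _ := GRing.isSubmodClosed.Build R V fullsm fullsm_closed.

End FullSubmodule.
Arguments fullsm {R} V.

Section ProductSubmodule.
Variables (R : comNzRingType) (V : lmodType R).
Variables (I : ideal R) (N : submodClosed V).

Definition mulsm : {pred V} := fun v =>
  `[< exists n (a : 'I_n -> R) (u : 'I_n -> V),
      [/\ forall i, a i \in I, forall i, u i \in N &
          v = \sum_i a i *: u i] >].

Fact mulsm_closed : submod_closed mulsm.
Proof.
split.
  apply/asboolP; exists 0, (fun=> 0), (fun=> 0).
  by split=> [[]//|[]//|]; rewrite big_ord0.
move=> c u v /asboolP[p [a [s [aI sN ->]]]] /asboolP[q [b [t [bI tN ->]]]].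
apply/asboolP; exists (p + q)%N.
exists (fun i => match split i with inl k => c * a k | inr k => b k end).
exists (fun i => match split i with inl k => s k | inr k => t k end).
split=> [i|i|]; try by case: split => k //; apply: (rpredZ c (aI k)).
rewrite big_split_ord scaler_sumr; congr (_ + _); apply: eq_bigr => k _.
  by rewrite (unsplitK (inl _ k)) scalerA.
by rewrite (unsplitK (inr _ k)).
Qed.

HB.instance Definition _ := GRing.isSubmodClosed.Build R V mulsm mulsm_closed.

End ProductSubmodule.

Fact mem_mulsm (R : comNzRingType) (V : lmodType R) (I : ideal R)
  (N : submodClosed V) a v : a \in I -> v \in N -> a *: v \in mulsm I N.
Proof.
move=> aI vN; apply/asboolP; exists 1%N, (fun=> a), (fun=> v).
by split=> //; rewrite big_ord1.
Qed.

Fixpoint idealX (R : comNzRingType) (I : ideal R) (n : nat) : ideal R :=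
  if n is p.+1 then mulsm I (idealX I p) else fullsm R^o.

Definition powsm (R : comNzRingType) (I : ideal R) (n : nat) (V : lmodType R) :
  submodClosed V := mulsm (idealX I n) (fullsm V).

Section PowerFacts.
Variables (R : comNzRingType) (I : ideal R).

Fact powsm0 (V : lmodType R) v : v \in powsm I 0 V.
Proof. by rewrite -[v]scale1r; apply: mem_mulsm. Qed.

Fact powsm_map (V W : lmodType R) (f : {linear V -> W}) n v :
  v \in powsm I n V -> f v \in powsm I n W.
Proof.
move=> /asboolP[p [a [u [aI _ ->]]]]; rewrite linear_sum rpred_sum // => i _.
by rewrite linearZ; apply: mem_mulsm.
Qed.

Fact powsm_mapS (V W : lmodType R) (f : {linear V -> W}) n v :
    (forall u, f u \in mulsm I (fullsm W)) ->
  v \in powsm I n V -> f v \in powsm I n.+1 W.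
Proof.
move=> fI /asboolP[p [a [u [aI _ ->]]]]; rewrite linear_sum rpred_sum // => i _.
rewrite linearZ /=; have /asboolP[q [b [w [bI _ ->]]]] := fI (u i).
rewrite scaler_sumr rpred_sum // => k _; rewrite scalerA mulrC.
by apply: mem_mulsm => //; apply: (mem_mulsm (bI k) (aI i)).
Qed.

End PowerFacts.

Section SubmoduleType.
Variables (R : comNzRingType) (V : lmodType R) (N : submodClosed V).

Record submod := Submod {submodval :> V; _ : submodval \in N}.

HB.instance Definition _ := [isSub for submodval].
HB.instance Definition _ := [Choice of submod by <:].
HB.instance Definition _ := GRing.SubChoice_isSubLmodule.Build R V
  (fun v => v \in N) submod (submodClosedP N).

End SubmoduleType.

Section QuotientModule.
Variables (R : comNzRingType) (V : lmodType R) (N : submodClosed V).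

(* The library's [submodClosed] is stated for semimodules, hence does not     *)
(* inherit from [zmodClosed], which [Quotient.quot] expects.                  *)
Definition zmod_of : {pred V} := fun v => v \in N.

Fact zmod_of_closed : zmod_closed zmod_of.
Proof. exact: GRing.submod_closedB (submodClosedP N). Qed.

HB.instance Definition _ := GRing.isZmodClosed.Build V zmod_of zmod_of_closed.

Definition quotmod := Quotient.quot zmod_of.

HB.instance Definition _ := GRing.Zmodule.on quotmod.
HB.instance Definition _ := Quotient.on quotmod.

Definition quot_scale (a : R) (q : quotmod) : quotmod := \pi_quotmod (a *: repr q).

Fact quot_piP (u v : V) : \pi_quotmod u = \pi_quotmod v <-> u - v \in N.
Proof.
have -> : (u - v \in N) = (u - v \in zmod_of) by [].
by rewrite Quotient.idealrBE; split=> /eqP.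
Qed.

Fact quot_piD : {morph \pi_quotmod : u v / u + v}.
Proof. exact: Quotient.pi_add. Qed.

Fact quot_pi0 : \pi_quotmod 0 = 0.
Proof. by apply: (addrI (\pi_quotmod 0)); rewrite -quot_piD !addr0. Qed.

Fact quot_scale_pi a v : quot_scale a (\pi v) = \pi_quotmod (a *: v).
Proof. by apply/quot_piP; rewrite -scalerBr rpredZ //; apply/quot_piP; rewrite reprK. Qed.

Fact quot_scaleA a b q : quot_scale a (quot_scale b q) = quot_scale (a * b) q.
Proof. by rewrite -[q]reprK !quot_scale_pi scalerA. Qed.

Fact quot_scale1 : left_id 1 quot_scale.
Proof. by move=> q; rewrite -[q]reprK quot_scale_pi scale1r. Qed.

Fact quot_scaleDr : right_distributive quot_scale +%R.
Proof.
by move=> a p q; rewrite -[p]reprK -[q]reprK -quot_piD !quot_scale_pi scalerDr quot_piD.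
Qed.

Fact quot_scaleDl q : {morph quot_scale^~ q : a b / a + b}.
Proof. by move=> a b; rewrite -[q]reprK !quot_scale_pi scalerDl quot_piD. Qed.

HB.instance Definition _ := GRing.Zmodule_isLmodule.Build R quotmod
  quot_scaleA quot_scale1 quot_scaleDr quot_scaleDl.

End QuotientModule.

Section Subquotient.
Variables (R : comNzRingType) (V : lmodType R) (A B : submodClosed V).

Definition restrsm : {pred submod A} := fun u => val u \in B.

Fact restrsm_closed : submod_closed restrsm.
Proof.
split=> [|a u v uB vB]; first exact: rpred0.
by rewrite /restrsm unfold_in /= rpredD ?rpredZ.
Qed.

HB.instance Definition _ :=
  GRing.isSubmodClosed.Build R (submod A) restrsm restrsm_closed.

(* A / (A :&: B); it is only used for B contained in A. *)
Definition subquot : lmodType R := quotmod restrsm.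

End Subquotient.

Section SubquotientMap.
Variables (R : comNzRingType) (V W : lmodType R) (f : {linear V -> W}).
Variables (A B : submodClosed V) (A' B' : submodClosed W).
Hypotheses (fA : forall u, u \in A -> f u \in A').
Hypotheses (fB : forall u, u \in B -> f u \in B').

Definition submod_fun (u : submod A) : submod A' := Submod (fA (valP u)).

Definition subquot_fun (q : subquot A B) : subquot A' B' :=
  \pi_(quotmod _) (submod_fun (repr (q : quotmod _))).

Fact subquot_fun_pi u :
  subquot_fun (\pi_(quotmod _) u) = \pi_(quotmod _) (submod_fun u).
Proof.
apply/quot_piP; rewrite unfold_in /= -linearB fB //.
by have /quot_piP := reprK (\pi_(quotmod (restrsm B)) u).
Qed.

Fact subquot_fun_linear : linear subquot_fun.
Proof.
move=> a p q; rewrite -[p]reprK -[q]reprK.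
rewrite -[a *: _]/(quot_scale a _) quot_scale_pi -quot_piD !subquot_fun_pi.
rewrite -[a *: _ in RHS]/(quot_scale a _) quot_scale_pi -quot_piD.
by congr (\pi _); apply: val_inj; rewrite /= linearP.
Qed.

Definition subquot_map : {linear subquot A B -> subquot A' B'} :=
  HB.pack subquot_fun
    (GRing.isLinear.Build R (subquot A B) (subquot A' B') *:%R subquot_fun
       subquot_fun_linear).

End SubquotientMap.

Fact subquot_map_comp0 (R : comNzRingType) (U V W : lmodType R)
    (f : {linear U -> V}) (g : {linear V -> W})
    (A B : submodClosed U) (A' B' : submodClosed V) (A'' B'' : submodClosed W)
    (fA : forall u, u \in A -> f u \in A') (fB : forall u, u \in B -> f u \in B')
    (gA : forall v, v \in A' -> g v \in A'') (gB : forall v, v \in B' -> g v \in B'') :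
  (forall u, g (f u) = 0) ->
  forall q, subquot_map gA gB (subquot_map fA fB q) = 0.
Proof.
move=> gf0 q; rewrite -[q]reprK /= !subquot_fun_pi // -quot_pi0.
by congr (\pi _); apply: val_inj; rewrite /= gf0.
Qed.

(* ... -> C_2 -> C_1 -> C_0 -> M -> 0, not necessarily exact. *)
Record augcomplex (R : comNzRingType) (M : lmodType R) := AugComplex {
  chain :> nat -> lmodType R;
  diff : forall n, {linear chain n.+1 -> chain n};
  aug : {linear chain 0 -> M};
  diffK : forall n u, diff n (diff n.+1 u) = 0;
  augK : forall u, aug (diff 0 u) = 0
}.

Definition is_exact (R : comNzRingType) (U V W : lmodType R)
  (f : {linear U -> V}) (g : {linear V -> W}) :=
  forall v, g v = 0 <-> exists u, f u = v.

(* Exactness everywhere, at M included. *)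
Definition acyclic (R : comNzRingType) (M : lmodType R) (C : augcomplex M) :=
  [/\ forall v, exists u, aug C u = v,
      is_exact (diff C 0) (aug C) &
      forall n, is_exact (diff C n.+1) (diff C n)].

Definition minimal (R : comNzRingType) (m : ideal R) (M : lmodType R)
  (C : augcomplex M) := forall n u, diff C n u \in mulsm m (fullsm (C n)).

Record minfreeres (R : comNzRingType) (m : ideal R) (M : lmodType R)
    (C : augcomplex M) : Prop := MinFreeRes {
  minfreeres_free : forall n, finfree (C n);
  minfreeres_acyclic : acyclic C;
  minfreeres_minimal : minimal m C
}.

Section LinearPart.
Variables (R : comNzRingType) (m : ideal R) (M : lmodType R).

Definition gradedpiece (p q : nat) (V : lmodType R) : lmodType R :=
  subquot (powsm m p V) (powsm m q V).

Variables (C : augcomplex M) (minC : minimal m C) (j : nat).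

Fact lin_mem i n (u : C n.+1) :
  u \in powsm m (i - n.+1) (C n.+1) -> diff C n u \in powsm m (i - n) (C n).
Proof.
have [le_in|lt_ni] := leqP i n.
  by move=> _; rewrite (eqP le_in) powsm0.
by rewrite -(subnSK lt_ni); apply: powsm_mapS.
Qed.

Fact lin_mem_aug i (u : C 0) :
  u \in powsm m (i - 0) (C 0) -> aug C u \in powsm m i M.
Proof. by rewrite subn0; apply: powsm_map. Qed.

(* The module in degree n is m^(j-n) C_n / m^(j+1-n) C_n. Subtraction on nat  *)
(* is truncated, so that for n > j it is C_n / C_n = 0, as it should be. The  *)
(* R-modules below are killed by m, hence are k-vector spaces for k = R/m,    *)
(* and R-linear maps between them are the same as k-linear ones.              *)
Definition lin_chain (n : nat) : lmodType R :=
  gradedpiece (j - n) (j.+1 - n) (C n).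

Definition lin_diff n : {linear lin_chain n.+1 -> lin_chain n} :=
  subquot_map (f := diff C n) (@lin_mem j n) (@lin_mem j.+1 n).

Definition lin_aug : {linear lin_chain 0 -> gradedpiece j j.+1 M} :=
  subquot_map (f := aug C) (@lin_mem_aug j) (@lin_mem_aug j.+1).

Fact lin_diffK n u : lin_diff n (lin_diff n.+1 u) = 0.
Proof. by apply: subquot_map_comp0; apply: diffK. Qed.

Fact lin_augK u : lin_aug (lin_diff 0 u) = 0.
Proof. by apply: subquot_map_comp0; apply: augK. Qed.

Definition lin : augcomplex (gradedpiece j j.+1 M) :=
  AugComplex lin_diffK lin_augK.

End LinearPart.

Definition Koszul (R : comNzRingType) (m : ideal R) (M : lmodType R) :=
  forall (C : augcomplex M) (resC : minfreeres m C) (j : nat),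
    acyclic (lin (minfreeres_minimal resC) j).

Definition noetherian (R : comNzRingType) := forall I : ideal R, fingen (submod I).

Definition maximal_ideal (R : comNzRingType) (I : ideal R) :=
  1 \notin I /\
  forall J : ideal R, {subset I <= J} -> 1 \notin J -> {subset J <= I}.

Definition local_ring (R : comNzRingType) (m : ideal R) :=
  [/\ noetherian R, maximal_ideal m &
      forall n : ideal R, maximal_ideal n -> n =i m].

Definition Conca_generator (R : comNzRingType) (J : ideal R) (x : R) :=
  [/\ x \in J, x != 0, x ^+ 2 = 0 &
      forall y, y \in idealX J 2 <-> exists2 z : R, z \in J & y = x * z].

(* Main.v *)
Require Import Defs.
From HB Require Import structures.
From mathcomp Require Import all_boot all_order all_algebra.
From mathcomp Require Import generic_quotient boolp ring.

(* Since m^2 = x m and x^2 = 0, also m^3 = 0. Let F be a minimal free         *)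
(* resolution of M and Z_n the kernel of the map out of F_n. The property     *)
(* that passes from one syzygy to the next is that F_n has an ordered basis   *)
(* g_i with z_i = x g_i - \sum_(l < i) c_il g_l in Z_n, all c_il in m. It     *)
(* holds for n = 0 with c = 0, because x M = 0. Given it for n:               *)
(* - multiplying z_i by m and inducting on i gives m^2 F_n = \sum_i m z_i,    *)
(*   hence m^2 F_n = m Z_n;                                                   *)
(* - the z_i are independent modulo m Z_n, because x is not in m^2, so they   *)
(*   lift to part of a basis of F_(n+1);                                      *)
(* - x z_i is in \sum_(l < i) m z_l, and x w is in m^2 F_n = \sum_l m z_l for *)
(*   all w in Z_n, so listing the lifts of the z_i before the other basis     *)
(*   elements of F_(n+1) gives the property for n + 1.                        *)
(* As m^3 = 0, the equalities m^2 F_n = m Z_n are all that the acyclicity of  *)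
(* the complexes lin_j(F) requires.                                           *)

Set Implicit Arguments.
Unset Strict Implicit.
Unset Printing Implicit Defensive.

Import GRing.Theory.
Local Open Scope ring_scope.

(** As m^2 = x m, an element of m^2 can be divided by x with quotient in m, so the z_i give a
    triangular system with x on the diagonal. [lift_idealX2] solves it by back-substitution. This
    yields m^2 F_n = m Z_n in [triangular_powsm2] and, together with [lift_indep] and
    [indep_extend_basis], the passage to the next syzygy in [triangular_diff].
    [triangular_lin_exact] turns the equalities into exactness in positive degrees. *)

Section Ideals.
Variables (R : comNzRingType) (I : ideal R).

Lemma idealMl (a b : R) : b \in I -> a * b \in I.
Proof. by move=> bI; exact: (@rpredZ R R^o I a b bI). Qed.

Lemma idealMr (a b : R) : a \in I -> a * b \in I.
Proof. by rewrite mulrC; exact: idealMl. Qed.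

Lemma idealX1 (a : R) : (a \in idealX I 1) = (a \in I).
Proof.
apply/idP/idP => [/asboolP[n [b [u [bI _ ->]]]]|aI].
  by apply: rpred_sum => i _; apply: idealMr.
by rewrite -[a]mulr1; apply: (@mem_mulsm R R^o).
Qed.

Lemma idealX2_mul (a b : R) : a \in I -> b \in I -> a * b \in idealX I 2.
Proof. by move=> aI bI; apply: (@mem_mulsm R R^o) => //; rewrite idealX1. Qed.

Lemma powsm1 (V : lmodType R) (v : V) :
  (v \in powsm I 1 V) = (v \in mulsm I (fullsm V)).
Proof.
by apply/asboolP/asboolP => -[n [a [u [aI uV ->]]]]; exists n, a, u; split=> // i;
   rewrite ?idealX1 // -idealX1.
Qed.

End Ideals.

(** * Bases of free modules *)

Section Bases.
Variables (R : comNzRingType) (V : lmodType R).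

Definition is_basis (n : nat) (g : 'I_n -> V) :=
  (forall v, exists c : 'I_n -> R, v = \sum_i c i *: g i) /\
  (forall c : 'I_n -> R, \sum_i c i *: g i = 0 -> forall i, c i = 0).

Lemma finfree_basis : finfree V -> exists n (g : 'I_n -> V), is_basis g.
Proof.
move=> [n [f [h fK hK]]]; exists n, (fun i => f (delta_mx 0 i)).
have fE (c : 'I_n -> R) :
    \sum_i c i *: f (delta_mx 0 i) = f (\row_i c i).
  rewrite [in RHS](row_sum_delta (\row_i c i)) linear_sum.
  by apply: eq_bigr => i _; rewrite linearZ mxE.
split=> [v|c].
  exists (fun i => h v 0 i); rewrite fE -[v in LHS]hK; congr (f _).
  by apply/rowP => i; rewrite mxE.
rewrite fE -(linear0 f) => /(can_inj fK)/rowP c0 i.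
by have := c0 i; rewrite !mxE.
Qed.

Variables (I : ideal R) (n : nat) (g : 'I_n -> V).

Lemma sum_mulsm (c : 'I_n -> R) (P : pred 'I_n) :
  (forall i, P i -> c i \in I) -> \sum_(i | P i) c i *: g i \in mulsm I (fullsm V).
Proof. by move=> cI; apply: rpred_sum => i Pi; apply: mem_mulsm => //; apply: cI. Qed.

Hypothesis bg : is_basis g.

Lemma basis_uniq (a b : 'I_n -> R) :
  \sum_i a i *: g i = \sum_i b i *: g i -> forall i, a i = b i.
Proof.
move=> ab i; apply/eqP; rewrite -subr_eq0; apply/eqP.
apply: (bg.2 (fun i => a i - b i)).
under eq_bigr do rewrite scalerBl.
by rewrite sumrB ab subrr.
Qed.

Lemma mulsm_coord (v : V) : v \in mulsm I (fullsm V) ->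
  exists2 c : 'I_n -> R, (forall i, c i \in I) & v = \sum_i c i *: g i.
Proof.
move=> /asboolP[p [a [u [aI _ ->]]]].
have [c cE] := fin_all_exists (fun k : 'I_p => bg.1 (u k)).
exists (fun i => \sum_k a k * c k i).
  by move=> i; apply: rpred_sum => k _; apply: idealMr.
under eq_bigr => k _ do rewrite cE scaler_sumr.
rewrite exchange_big; apply: eq_bigr => i _.
by rewrite scaler_suml; apply: eq_bigr => k _; rewrite scalerA.
Qed.

Lemma coord_mulsm (c : 'I_n -> R) :
  \sum_i c i *: g i \in mulsm I (fullsm V) -> forall i, c i \in I.
Proof. by move=> /mulsm_coord[b bI /basis_uniq cb] i; rewrite cb. Qed.

(** Steinitz exchange: [a l] is a unit, so the combination can be solved for [g l]. *)
Lemma basis_exchange (a : 'I_n -> R) (l : 'I_n) (b : R) : b * a l = 1 ->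
  is_basis (fun i => if i == l then \sum_i a i *: g i else g i).
Proof.
move=> ba1; set v := \sum_i a i *: g i; set h := fun i => _.
have hE c : \sum_i c i *: h i =
    \sum_i (c l * a i + (if i == l then 0 else c i)) *: g i.
  rewrite (bigD1 l) //= {1}/h eqxx.
  under [RHS]eq_bigr do rewrite scalerDl -scalerA.
  rewrite big_split -scaler_sumr; congr (_ + _).
  rewrite [RHS](bigD1 l) //= eqxx scale0r add0r.
  by apply: eq_bigr => i /negPf il; rewrite /h il.
split=> [w|c].
  have [c ->] := bg.1 w.
  exists (fun i => if i == l then c l * b else c i - c l * b * a i).
  rewrite hE eqxx; apply: eq_bigr => i _; congr (_ *: _).
  have [->|_] := eqVneq i l; first by rewrite addr0 -mulrA ba1 mulr1.
  by rewrite addrC subrK.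
rewrite hE => /(bg.2) c0.
have cl0 : c l = 0.
  have := c0 l; rewrite eqxx addr0 => /(congr1 ( *%R b)).
  by rewrite mulr0 mulrCA ba1 mulr1.
by move=> i; have := c0 i; rewrite cl0 mul0r add0r; case: eqP => [->|].
Qed.

End Bases.

(** * Local algebra with a Conca generator *)

Section IdealExtension.
Variables (R : comNzRingType) (I : ideal R) (a : R).

Definition idealD1 : {pred (R : comNzRingType)^o} :=
  fun y => `[< exists2 u, u \in I & exists b, y = u + b * a >].

Fact idealD1_closed : submod_closed idealD1.
Proof.
split; first by apply/asboolP; exists 0; [exact: rpred0 | exists 0; rewrite mul0r addr0].
move=> c y z /asboolP[u uI [b ->]] /asboolP[v vI [d ->]]; apply/asboolP.
exists (c * u + v); first by rewrite rpredD // idealMl.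
by exists (c * b + d); rewrite /GRing.scale /= mulrDr mulrDl mulrA addrACA.
Qed.

HB.instance Definition _ :=
  GRing.isSubmodClosed.Build R (R : comNzRingType)^o idealD1 idealD1_closed.

(** Otherwise I + R a would be a proper ideal, and maximality would put a in I. *)
Lemma maximal_ideal_inv_mod : maximal_ideal I -> a \notin I ->
  exists2 u, u \in I & exists b, 1 = u + b * a.
Proof.
move=> [_ maxI] aI; apply/asboolP; apply: contraNT aI => nJ1.
apply: (maxI idealD1) => //= [u uI|]; apply/asboolP.
  by exists u => //; exists 0; rewrite mul0r addr0.
by exists 0; [exact: rpred0 | exists 1; rewrite mul1r add0r].
Qed.

End IdealExtension.

Section ConcaLocal.
Variables (R : comNzRingType) (m : ideal R) (x : R).
Hypotheses (max_m : maximal_ideal m) (conca_x : Conca_generator m x).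

Lemma conca_mem : x \in m. Proof. by case: conca_x. Qed.
Lemma conca_sqr : x * x = 0. Proof. by rewrite -expr2; case: conca_x. Qed.

Lemma conca_idealX2 (y : R) : y \in idealX m 2 -> exists2 z, z \in m & y = x * z.
Proof. by case: conca_x => _ _ _ /(_ y)[]. Qed.

Lemma conca_mulX2 (z : R) : z \in m -> x * z \in idealX m 2.
Proof. by move=> zm; apply: idealX2_mul => //; apply: conca_mem. Qed.

(** For a, z in m, the product a z is in m^2, so a z = x w and a (x z) = x^2 w = 0. *)
Lemma conca_idealX3 (p : nat) (y : R) : y \in idealX m p.+3 -> y = 0.
Proof.
suff prod0 a b : a \in m -> b \in idealX m p.+2 -> a * b = 0.
  by move=> /asboolP[n [a [u [am um ->]]]]; apply: big1 => i _; apply: prod0.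
move=> am bm; have : b \in idealX m 2.
  elim: p b bm => // p IH b /asboolP[n [c [u [cm um ->]]]].
  by apply: rpred_sum => i _; apply: idealMl; apply: IH.
case/conca_idealX2 => z zm ->; have [w _ azE] := conca_idealX2 (idealX2_mul am zm).
by rewrite mulrCA azE mulrA conca_sqr mul0r.
Qed.

Lemma conca_powsm3 (p : nat) (V : lmodType R) (v : V) :
  v \in powsm m p.+3 V -> v = 0.
Proof.
move=> /asboolP[n [a [u [am _ ->]]]]; apply: big1 => i _.
by rewrite (conca_idealX3 (am i)) scale0r.
Qed.

(** Modulo m there is an inverse b, so b a = 1 - u with u in m. Since u^3 = 0, the geometric series
    inverts 1 - u. *)
Lemma conca_nonmem_unit (a : R) : a \notin m -> exists b, b * a = 1.
Proof.
move=> /(maximal_ideal_inv_mod max_m)[u um [b E]].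
have u3 : u ^+ 3 = 0.
  rewrite exprS; apply: (@conca_idealX3 0).
  by apply: (@mem_mulsm R R^o) => //; apply: idealX2_mul.
have ba : b * a = 1 - u by rewrite E addrC addKr.
exists ((1 + u + u ^+ 2) * b); rewrite -mulrA ba.
have -> : (1 + u + u ^+ 2) * (1 - u) = 1 - u ^+ 3 by ring.
by rewrite u3 subr0.
Qed.

(** If a were a unit, x would be in m^2, so x = x z with z in m. As 1 - z is a unit, this forces x =
    0. *)
Lemma conca_mul_mem (a : R) : a * x \in idealX m 2 -> a \in m.
Proof.
move=> axm; apply: contraT => /conca_nonmem_unit[b ba1].
have : x \in idealX m 2 by rewrite -[x]mul1r -ba1 -mulrA idealMl.
case/conca_idealX2 => z zm xE.
have : 1 - z \notin m.
  by apply: contra max_m.1 => z1; rewrite -(subrK z 1) rpredD.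
case/conca_nonmem_unit => c c1; have [_ /eqP[]//] := conca_x.
by rewrite -[x]mul1r -c1 -mulrA mulrBl mul1r [z * x]mulrC -xE subrr mulr0.
Qed.

(** The u_i are exchanged into the basis one at a time. When the new vector is expanded in a basis
    containing the others, some coefficient outside their positions is a unit. Otherwise the new
    vector would be a combination of the others modulo m V, a relation with coefficient 1. *)
Lemma indep_extend_basis (V : lmodType R) (b n : nat) (u : 'I_b -> V)
    (g : 'I_n -> V) :
    (forall a : 'I_b -> R, \sum_i a i *: u i \in mulsm m (fullsm V) ->
      forall i, a i \in m) ->
    is_basis g ->
  exists (h : 'I_n -> V) (s : 'I_b -> 'I_n),
    [/\ is_basis h, injective s & forall i, h (s i) = u i].
Proof.
elim: b u => [|b IH] u indep bg.
  by exists g, (fun i : 'I_0 => match notF (ltn_ord i) with end); split=> // -[].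
have [|//|h [s [bh inj_s hs]]] := IH (fun j => u (lift ord0 j)).
  move=> a am i; pose a' j := if unlift ord0 j is Some k then a k else 0.
  have := indep a' _ (lift ord0 i); rewrite /a' liftK; apply.
  rewrite big_ord_recl unlift_none scale0r add0r.
  by under eq_bigr do rewrite liftK.
have [a uE] := bh.1 (u ord0).
have [l [ls lm]] : exists l, l \notin codom s /\ a l \notin m.
  apply: contrapT => no_l; case/negP: max_m.1.
  pose a' j := if unlift ord0 j is Some k then - a (s k) else 1.
  have := indep a' _ ord0; rewrite /a' unlift_none; apply.
  rewrite big_ord_recl unlift_none scale1r.
  under eq_bigr do rewrite liftK scaleNr -hs.
  rewrite sumrN uE (bigID (mem (codom s))) /= addrAC.
  rewrite -big_uniq; last exact/injectiveP.
  rewrite big_image subrr add0r.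
  apply: sum_mulsm => k ks; apply: contrapT => /negP am.
  by apply: no_l; exists k.
have [c ca1] := conca_nonmem_unit lm.
exists (fun i => if i == l then \sum_i a i *: h i else h i).
exists (fun i => if unlift ord0 i is Some k then s k else l).
have sl k : (s k == l) = false.
  by apply: contraNF ls => /eqP <-; apply: codom_f.
split; first exact: basis_exchange ca1.
  move=> i j; case: unliftP => [i' ->|->]; case: unliftP => [j' ->|->] //.
  - by move=> /inj_s ->.
  - by move=> /eqP; rewrite sl.
  - by move=> /esym/eqP; rewrite sl.
by move=> i; case: unliftP => [i' ->|->]; rewrite ?sl ?hs // eqxx.
Qed.

End ConcaLocal.

(** * Triangular bases and their passage to syzygies *)

Section Triangular.
Variables (R : comNzRingType) (m : ideal R) (x : R).
Hypotheses (max_m : maximal_ideal m) (conca_x : Conca_generator m x).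

(* The rank r stands for the order of the basis, so that no reindexing of the *)
(* basis is needed when the lifts of the z_i are put first.                   *)
Definition triangular (V W : lmodType R) (e : {linear V -> W}) :=
  exists n (g : 'I_n -> V) (r : 'I_n -> nat) (c : 'I_n -> 'I_n -> R),
    [/\ is_basis g, forall i l, c i l \in m,
        forall i l, (r i <= r l)%N -> c i l = 0 &
        forall i, e (x *: g i - \sum_l c i l *: g l) = 0].

Variables (F1 F0 W : lmodType R) (d : {linear F1 -> F0}) (e : {linear F0 -> W}).
Hypotheses (exact_de : is_exact d e).
Hypotheses (d_min : forall u, d u \in mulsm m (fullsm F0)).

Section Lift.
Variables (n : nat) (g : 'I_n -> F0) (r : 'I_n -> nat) (c : 'I_n -> 'I_n -> R).
Variable u : 'I_n -> F1.
Hypotheses (bg : is_basis g) (cm : forall i l, c i l \in m).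
Hypothesis (c_tri : forall i l, (r i <= r l)%N -> c i l = 0).
Hypothesis du : forall i, d (u i) = x *: g i - \sum_l c i l *: g l.

(** By [c_tri], coordinate i involves, besides t_i x, only those t_l with r l > r i. *)
Lemma d_sum_lift (t : 'I_n -> R) :
  d (\sum_i t i *: u i) = \sum_i (t i * x - \sum_l t l * c l i) *: g i.
Proof.
rewrite linear_sum; under eq_bigr do rewrite linearZ /= du scalerBr scalerA.
under [RHS]eq_bigr do rewrite scalerBl.
rewrite !sumrB; congr (_ - _).
under eq_bigr do rewrite scaler_sumr.
rewrite exchange_big; apply: eq_bigr => i _.
by rewrite scaler_suml; apply: eq_bigr => l _; rewrite scalerA.
Qed.

(** Back-substitution from the highest rank down. The bound k on the ranks that occur drives the
    induction, and its survival in p makes the next syzygy triangular. *)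
Lemma lift_idealX2 (k : nat) (a : 'I_n -> R) :
    (forall i, a i \in idealX m 2) -> (forall i, (k <= r i)%N -> a i = 0) ->
  exists p : 'I_n -> R,
    [/\ forall i, p i \in m, forall i, (k <= r i)%N -> p i = 0 &
        d (\sum_i p i *: u i) = \sum_i a i *: g i].
Proof.
elim: k a => [|k IH] a am ak.
  exists (fun=> 0); split=> // [i|]; first exact: rpred0.
  by rewrite !big1 ?linear0 // => i _; rewrite ?ak ?scale0r.
(* The quotient of 0 by x is not unique; choosing 0 above rank k keeps the support bounded. *)
have /fin_all_exists[t tE] : forall i, exists t,
    [/\ t \in m, a i = x * t & (k < r i)%N -> t = 0].
  move=> i; have [/ak ai0|_] := ltnP k (r i).
    by exists 0; rewrite mulr0 rpred0.
  by have [z] := conca_idealX2 conca_x (am i); exists z.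
(* The error left by t is again in m^2, and t_l c_li is nonzero only if r i < r l <= k. *)
have [||p [pm pk pE]] := IH (fun i => \sum_l t l * c l i).
- by move=> i; apply: rpred_sum => l _; apply: idealX2_mul => //; case: (tE l).
- move=> i ki; apply: big1 => l _; have [lk|kl] := leqP (r l) (r i).
    by rewrite c_tri ?mulr0.
  by have [_ _ ->] := tE l; rewrite ?mul0r // (leq_ltn_trans ki).
exists (fun i => t i + p i); split=> [i|i ki|].
- by apply: rpredD => //; case: (tE i).
- by have [_ _ ->] := tE i; rewrite // pk ?addr0 // ltnW.
under eq_bigr do rewrite scalerDl.
rewrite big_split raddfD /= pE d_sum_lift -big_split; apply: eq_bigr => i _ /=.
by have [_ -> _] := tE i; rewrite -scalerDl subrK mulrC.
Qed.

(** Minimality sends the combination into m^2 F0, so each a_i x - \sum_l a_l c_li is in m^2. By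
    descending induction on rank the sum is in m^2 too, hence so is a_i x, and a_i is in m. *)
Lemma lift_indep (a : 'I_n -> R) :
  \sum_i a i *: u i \in mulsm m (fullsm F1) -> forall i, a i \in m.
Proof.
move=> aum.
have : d (\sum_i a i *: u i) \in powsm m 2 F0.
  by apply: (powsm_mapS d_min); rewrite powsm1.
rewrite d_sum_lift => /(coord_mulsm bg) acm i.
have [k] := ubnP (\max_l r l - r i); elim: k i => // k IH i; rewrite ltnS => rk.
apply: (conca_mul_mem max_m conca_x).
rewrite -(subrK (\sum_l a l * c l i) (a i * x)).
apply: rpredD; first exact: acm.
apply: rpred_sum => l _; have [/c_tri ->|ril] := leqP (r l) (r i).
  by rewrite mulr0 rpred0.
apply: idealX2_mul => //; apply: IH; apply: leq_trans rk.
by rewrite ltn_sub2l // (leq_trans ril) // leq_bigmax.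
Qed.

End Lift.

Lemma triangular_lift (n : nat) (g : 'I_n -> F0) (c : 'I_n -> 'I_n -> R) :
    (forall i, e (x *: g i - \sum_l c i l *: g l) = 0) ->
  exists u : 'I_n -> F1, forall i, d (u i) = x *: g i - \sum_l c i l *: g l.
Proof.
move=> eg; apply: (fin_all_exists (P := fun i u => d u = _)) => i.
exact/exact_de.
Qed.

Lemma triangular_powsm2 (v : F0) : triangular e -> v \in powsm m 2 F0 ->
  exists2 w, w \in powsm m 1 F1 & d w = v.
Proof.
move=> [n [g [r [c [bg cm c_tri]]]]] /triangular_lift[u du].
move=> /(mulsm_coord bg)[a am ->].
(* With k above every rank, the support condition is vacuous. *)
have [|p [pm _ <-]] := lift_idealX2 cm c_tri du (k := (\max_i r i).+1) am.
  by move=> i; rewrite ltnNge leq_bigmax.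
by exists (\sum_i p i *: u i) => //; rewrite powsm1 sum_mulsm.
Qed.

Lemma triangular_diff : finfree F1 -> triangular e -> triangular d.
Proof.
move=> /finfree_basis[q [f bf]] [n [g [r [c [bg cm c_tri]]]]] /triangular_lift[u du].
have [h [s [bh inj_s hs]]] :=
  indep_extend_basis max_m conca_x (lift_indep bg cm c_tri du) bf.
pose K := (\max_i r i).+1.
(* Lifts keep the rank of their z_j; all other basis elements come after them. *)
pose rk l := if [pick j | s j == l] is Some j then r j else K.
have rk_s j : rk (s j) = r j.
  by rewrite /rk; case: pickP => [i /eqP/inj_s->|/(_ j)]; rewrite ?eqxx.
have rK j : (r j < K)%N by rewrite ltnS leq_bigmax.
have /fin_all_exists[p pE] : forall l, exists p : 'I_n -> R,
    [/\ forall j, p j \in m, forall j, (rk l <= r j)%N -> p j = 0 &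
        d (\sum_j p j *: u j) = x *: d (h l)].
  move=> l.
  have [a [am xdh] ak] : exists2 a : 'I_n -> R,
      (forall i, a i \in idealX m 2) /\ x *: d (h l) = \sum_i a i *: g i &
      forall i, (rk l <= r i)%N -> a i = 0.
    rewrite /rk; case: pickP => [j /eqP <-|_].
      (* Since x^2 = 0, only the lower terms of z_j survive multiplication by x. *)
      exists (fun i => x * - c j i) => [|i /c_tri->]; last by rewrite oppr0 mulr0.
      split=> [i|]; first by apply: (conca_mulX2 conca_x); rewrite -mulN1r idealMl.
      rewrite hs du scalerBr scalerA (conca_sqr conca_x) scale0r sub0r.
      by rewrite scaler_sumr -sumrN; apply: eq_bigr => i _; rewrite scalerA mulrN scaleNr.
    have [a am ->] := mulsm_coord bg (d_min (h l)).
    exists (fun i => x * a i); last by move=> i; rewrite leqNgt rK.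
    split=> [i|]; first exact: (conca_mulX2 conca_x).
    by rewrite scaler_sumr; apply: eq_bigr => i _; rewrite scalerA.
  have [p [pm pk dp]] := lift_idealX2 cm c_tri du am ak.
  by exists p; split=> //; rewrite dp xdh.
(* The coefficients p are moved along the injection s and extended by zero. *)
exists q, h, rk, (fun l k => \sum_(j | s j == k) p l j); split=> //.
- by move=> l k; apply: rpred_sum => j _; case: (pE l).
- move=> l k lk; apply: big1 => j /eqP sj.
  by have [_ -> //] := pE l; rewrite -rk_s sj.
move=> l; rewrite linearB linearZ /=; have [_ _ <-] := pE l.
rewrite -linearB -[RHS](linear0 d) (partition_big s xpredT) //= -sumrB.
congr (d _); apply: big1 => k _; rewrite scaler_suml -sumrB.
by apply: big1 => j /eqP <-; rewrite hs subrr.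
Qed.

End Triangular.

(** * Exactness of the linear part *)

Lemma subquot_map_exact (R : comNzRingType) (U V W : lmodType R)
    (f : {linear U -> V}) (g : {linear V -> W})
    (A B : submodClosed U) (A' B' : submodClosed V) (A'' B'' : submodClosed W)
    (fA : forall u, u \in A -> f u \in A') (fB : forall u, u \in B -> f u \in B')
    (gA : forall v, v \in A' -> g v \in A'') (gB : forall v, v \in B' -> g v \in B'') :
  (forall u, g (f u) = 0) ->
  (forall v, v \in A' -> g v \in B'' -> exists2 u, u \in A & v - f u \in B') ->
  is_exact (subquot_map fA fB) (subquot_map gA gB).
Proof.
move=> gf0 lift q; split=> [|[p <-]]; last exact: subquot_map_comp0.
rewrite -[q]reprK /= (subquot_fun_pi gA gB) => gv0.
have /quot_piP := etrans gv0 (esym (quot_pi0 _)); rewrite subr0 => gv.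
have [u uA vfu] := lift _ (valP (repr q)) gv.
exists (\pi_(quotmod _)%qT (Submod uA)); rewrite /= (subquot_fun_pi fA fB).
apply/esym/quot_piP; exact: vfu.
Qed.

Lemma subquot_map_surj (R : comNzRingType) (U V : lmodType R)
    (f : {linear U -> V}) (A B : submodClosed U) (A' B' : submodClosed V)
    (fA : forall u, u \in A -> f u \in A') (fB : forall u, u \in B -> f u \in B') :
  (forall v, v \in A' -> exists2 u, u \in A & f u = v) ->
  forall q, exists p, subquot_map fA fB p = q.
Proof.
move=> lift q; have [u uA fu] := lift _ (valP (repr q)).
exists (\pi_(quotmod _)%qT (Submod uA)).
rewrite /= (subquot_fun_pi fA fB) -[RHS]reprK; congr (\pi _)%qT.
exact: val_inj.
Qed.

Lemma powsm_surj (R : comNzRingType) (I : ideal R) (V W : lmodType R)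
    (f : {linear V -> W}) (p : nat) (w : W) :
  (forall w, exists v, f v = w) -> w \in powsm I p W ->
  exists2 v, v \in powsm I p V & f v = w.
Proof.
move=> surj_f /asboolP[n [a [u [aI _ ->]]]].
have /fin_all_exists[v fv] : forall i, exists v, f v = u i by move=> i; apply: surj_f.
exists (\sum_i a i *: v i); first by apply: rpred_sum => i _; apply: mem_mulsm.
by rewrite linear_sum; apply: eq_bigr => i _; rewrite linearZ /= fv.
Qed.

(** For p = 0, e v is in m^3 W = 0 and exactness applies; for p = 1, m^2 F0 is the image of m F1;
    for larger p, v = 0. *)
Lemma triangular_lin_exact (R : comNzRingType) (m : ideal R) (x : R)
    (F1 F0 W : lmodType R) (d : {linear F1 -> F0}) (e : {linear F0 -> W})
    (p : nat) (v : F0) :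
    Conca_generator m x -> is_exact d e -> triangular m x e ->
    v \in powsm m p.+1 F0 -> e v \in powsm m p.+3 W ->
  exists2 u, u \in powsm m p F1 & d u = v.
Proof.
move=> conca_x ex_de tri vm ev; case: p vm ev => [|[|p]] vm ev.
- have /ex_de[u <-] := conca_powsm3 conca_x ev.
  by exists u => //; apply: powsm0.
- exact: (triangular_powsm2 conca_x ex_de tri vm).
- by exists 0; rewrite ?rpred0 // linear0 (conca_powsm3 conca_x vm).
Qed.

Theorem theorem3p2 (R : comNzRingType) (m : ideal R) (x : R) (M : lmodType R) :
  local_ring m -> Conca_generator m x ->
  fingen M -> (forall v : M, x *: v = 0) -> Koszul m M.
Proof.
move=> [_ max_m _] conca_x _ xM C [freeC [surjC ex0 exC] minC] j.
have ker0 u : aug C u = 0 -> u \in mulsm m (fullsm (C 0)).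
  by move=> /ex0[v <-]; apply: minC.
have kerC n u : diff C n u = 0 -> u \in mulsm m (fullsm (C n.+1)).
  by move=> /exC[v <-]; apply: minC.
have tri0 : triangular m x (aug C).
  have [n [g bg]] := finfree_basis (freeC 0).
  exists n, g, (fun=> 0%N), (fun _ _ => 0); split=> // [i l|i]; first exact: rpred0.
  by rewrite linearB linearZ /= xM big1 ?linear0 ?addr0 // => l _; rewrite scale0r.
have triC n : triangular m x (diff C n).
  elim: n => [|n IH].
    exact: (triangular_diff max_m conca_x ex0 (minC 0) (freeC 1) tri0).
  exact: (triangular_diff max_m conca_x (exC n) (minC _) (freeC _) IH).
(* Here m^2 M = m x M = 0. *)
have m2M p v : v \in powsm m p.+2 M -> v = 0.
  case: p => [|p]; last exact: (conca_powsm3 conca_x).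
  move=> /asboolP[n [a [u [am _ ->]]]]; apply: big1 => i _.
  by have [z _ ->] := conca_idealX2 conca_x (am i); rewrite -scalerA xM.
have liftC n v : v \in powsm m 2 (C n) ->
    exists2 w, w \in powsm m 1 (C n.+1) & diff C n w = v.
  by case: n v => [|n] v; [apply: (triangular_powsm2 conca_x ex0 tri0)
                          | apply: (triangular_powsm2 conca_x (exC n) (triC n))].
split.
- by apply: subquot_map_surj => v; rewrite ?subn0; apply: powsm_surj.
- rewrite /= /lin_diff /lin_aug; apply: subquot_map_exact => [|v]; first exact: augK.
  rewrite !subn0; case: j => [|p] vm ev.
    (* In degree 0, v differs from an element of m F_0 by a kernel element, which is in m F_0 by
       minimality; so the class of v is zero. *)
    have [w wm we] := powsm_surj surjC ev.
    exists 0; rewrite ?rpred0 // linear0 subr0 -(subrK w v) rpredD // powsm1.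
    by apply: ker0; rewrite linearB /= we subrr.
  have [|u um <-] := triangular_lin_exact conca_x ex0 tri0 vm.
    by rewrite (m2M _ _ ev) rpred0.
  by exists u; rewrite ?subrr ?rpred0 // subSS subn0.
- move=> n; rewrite /= /lin_diff; apply: subquot_map_exact => [|v]; first exact: diffK.
  (* If n + 1 > j the graded piece is zero; otherwise j = n + 1 + p. *)
  have [jn|/subnKC <-] := ltnP j n.+1.
    move=> _ _; exists 0; first exact: rpred0.
    by rewrite (eqP (jn : (j.+1 <= _)%N)) powsm0.
  move: (j - n.+1)%N => p.
  have -> : ((n.+1 + p).+1 - n = p.+2)%N by rewrite addSn -!addnS addKn.
  have -> : (n.+1 + p - n.+2 = p.-1)%N by rewrite -[n.+2]addn1 subnDA addKn subn1.
  rewrite -addnS !addKn => vm dv.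
  case: p vm dv => [|p] vm dv.
    (* For p = 0, d v is in m^2 F_n, hence is d w with w in m F_(n+1). As v - w is a cycle, it is in
       m F_(n+1), and the class of v is zero. *)
    have [w wm wd] := liftC _ _ dv.
    exists 0; rewrite ?rpred0 // linear0 subr0 -(subrK w v) rpredD // powsm1.
    by apply: kerC; rewrite linearB /= wd subrr.
  have [u um <-] := triangular_lin_exact conca_x (exC n) (triC n) vm dv.
  by exists u; rewrite ?subrr ?rpred0.
Qed.
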